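(* Let $X$ be a real or complex Banach space, let $U:\Delta_{+}\to\mathcal{B}(X)$ be an evolution operator and let $P:\mathbb{R}_{+}\to\mathcal{B}(X)$ be a projection valued function compatible with $U$. Then $U$ has a uniform exponential dichotomy with the dichotomy projection $P(\cdot)$ if and only if $U$ has $P$-uniform exponential growth and there exist $p>0$, $K\geq 1$ and $\gamma>0$ such that $$\int_{0}^{\infty}e^{p\gamma|\tau-t|}\,\|G(\tau,t)x\|^{p}\,d\tau\leq K\|x\|^{p}\quad\text{for all } t\geq 0 \text{ and } x\in X,$$ where $G$ is the Green function of $U$ and $P(\cdot)$.
   Context: Let $X$ be a real or complex Banach space, $\mathcal{B}(X)$ the Banach algebra of bounded linear operators on $X$, and $\Delta_{+}=\{(t,s)\in\mathbb{R}_{+}\times\mathbb{R}_{+}: t\geq s\}$, where $\mathbb{R}_+=[0,\infty)$. Evolution operator: a map $U:\Delta_{+}\to\mathcal{B}(X)$ with $U(t,t)=Id$ for all $t\ge 0$; $U(t,s)U(s,t_0)=U(t,t_0)$ for all $t\geq s\geq t_0\ge 0$; and $(t,s)\mapsto U(t,s)x$ continuous on $\Delta_{+}$ for every $x\in X$. Projection valued function: a strongly continuous map $P:\mathbb{R}_{+}\to\mathcal{B}(X)$ with $P(t)^2=P(t)$ for all $t$; write $Q(t)=Id-P(t)$, so $\operatorname{Ker}P(t)=\operatorname{Range}Q(t)$. Compatibility: $P(\cdot)$ is compatible with $U$ if $P(t)U(t,s)=U(t,s)P(s)$ for all $(t,s)\in\Delta_{+}$ and the restriction $U(t,s)|_{\operatorname{Ker}P(s)}:\operatorname{Ker}P(s)\to\operatorname{Ker}P(t)$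 is an isomorphism for each $(t,s)\in\Delta_{+}$; its inverse is denoted $V(s,t):\operatorname{Ker}P(t)\to\operatorname{Ker}P(s)$. Uniform exponential dichotomy with dichotomy projection $P(\cdot)$ (where $P$ is compatible with $U$): there exist $N\geq1$ and $\beta>0$ with $\|U(t,s)P(s)\|\leq Ne^{-\beta(t-s)}$ and $\|V(s,t)Q(t)\|\leq Ne^{-\beta(t-s)}$ for all $(t,s)\in\Delta_{+}$. $P$-uniform exponential growth: there exist $M\geq1$ and $\omega>0$ with $\|U(t,s)P(s)\|\leq Me^{\omega(t-s)}$ and $\|V(s,t)Q(t)\|\leq Me^{\omega(t-s)}$ for all $(t,s)\in\Delta_{+}$. Green function of $U$ and a compatible $P(\cdot)$: $G(t,s)=U(t,s)P(s)$ for $t>s\geq0$, and $G(t,s)=-V(t,s)Q(s)$ for $s>t\geq0$. *)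

(* Defs.v *)
From mathcomp Require Import all_boot all_order all_algebra.
From mathcomp Require Import complex.
From mathcomp Require Import all_classical all_reals all_analysis.
Import Order.TTheory GRing.Theory Num.Theory.
Import numFieldNormedType.Exports.

Set Implicit Arguments.
Unset Strict Implicit.
Unset Printing Implicit Defensive.

Local Open Scope classical_set_scope.
Local Open Scope ring_scope.

Variant scalar_kind := RealScalars | ComplexScalars.

Definition scalars (R : realType) (k : scalar_kind) : numFieldType :=
  match k with
  | RealScalars => R
  | ComplexScalars => (R[i])%C
  end.

Definition real_part (R : realType) (k : scalar_kind) : scalars R k -> R :=
  match k return scalars R k -> R with
  | RealScalars => fun z => z
  | ComplexScalars => fun z => complex.Re z
  end.

Section EvolutionOperators.
Variables (R : realType) (k : scalar_kind).
Variable X : completeNormedModType (scalars R k).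

(* The library norm `|x| takes its values in the scalar field (in R[i] for
   complex X, where it is a nonnegative real); rnorm is the same norm seen
   in R. *)
Definition rnorm (x : X) : R := real_part `|x|.

Definition bounded_operator (A : X -> X) : Prop :=
  linear A /\ exists C : R, forall x, rnorm (A x) <= C * rnorm x.

Definition opnorm (A : X -> X) : \bar R :=
  ereal_sup [set (rnorm (A x))%:E | x in [set x : X | rnorm x <= 1]].

Definition Delta_plus : set (R * R) := [set ts | 0 <= ts.2 <= ts.1].

(* U is only constrained on Delta_plus, and P only on [0, +oo[; their values
   elsewhere are junk and never used. *)
Definition evolution_operator (U : R -> R -> X -> X) : Prop :=
  [/\ forall t s, Delta_plus (t, s) -> bounded_operator (U t s),
      forall t, 0 <= t -> U t t = idfun,
      forall t s t0, 0 <= t0 -> t0 <= s -> s <= t ->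
        U t s \o U s t0 = U t t0
    & forall x, {within Delta_plus, continuous (fun ts => U ts.1 ts.2 x)}].

Definition projection_valued (P : R -> X -> X) : Prop :=
  [/\ forall t, 0 <= t -> bounded_operator (P t),
      forall x, {within `[0, +oo[, continuous (fun t => P t x)}
    & forall t, 0 <= t -> P t \o P t = P t].

Definition Qproj (P : R -> X -> X) (t : R) (x : X) : X := x - P t x.

Definition Ker (A : X -> X) : set X := [set x | A x = 0].

(* V s t = inverse of the restriction U t s : Ker (P s) -> Ker (P t),
   for 0 <= s <= t; it is only meaningful on Ker (P t). *)
Definition Vinv (U : R -> R -> X -> X) (P : R -> X -> X) (s t : R) : X -> X :=
  'pinv_(fun=> 0) (Ker (P s)) (U t s).

(* Isomorphism of normed spaces: a bijection with continuous inverse (U t s is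
   itself linear and bounded). *)
Definition compatible (U : R -> R -> X -> X) (P : R -> X -> X) : Prop :=
  forall t s, Delta_plus (t, s) ->
    [/\ P t \o U t s = U t s \o P s,
        set_bij (Ker (P s)) (Ker (P t)) (U t s)
      & {within Ker (P t), continuous (Vinv U P s t)}].

Definition uniform_exponential_dichotomy
    (U : R -> R -> X -> X) (P : R -> X -> X) : Prop :=
  exists N beta : R, [/\ 1 <= N, 0 < beta &
    forall t s, Delta_plus (t, s) ->
      (opnorm (U t s \o P s) <= (N * expR (- beta * (t - s)))%:E)%E /\
      (opnorm (Vinv U P s t \o Qproj P t)
         <= (N * expR (- beta * (t - s)))%:E)%E].

Definition uniform_exponential_growth
    (U : R -> R -> X -> X) (P : R -> X -> X) : Prop :=
  exists M omega : R, [/\ 1 <= M, 0 < omega &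
    forall t s, Delta_plus (t, s) ->
      (opnorm (U t s \o P s) <= (M * expR (omega * (t - s)))%:E)%E /\
      (opnorm (Vinv U P s t \o Qproj P t)
         <= (M * expR (omega * (t - s)))%:E)%E].

(* The Green function is undefined on the diagonal; the value 0 chosen there
   only affects a null set of the integrals in which it occurs. *)
Definition Green (U : R -> R -> X -> X) (P : R -> X -> X) (t s : R) (x : X)
    : X :=
  if s < t then U t s (P s x)
  else if t < s then - Vinv U P t s (Qproj P s x)
  else 0.

End EvolutionOperators.

(* Main.v *)
Require Import Defs.
From mathcomp Require Import all_boot all_order all_algebra.
From mathcomp Require Import complex ring lra.
From mathcomp Require Import all_classical all_reals all_analysis.
From mathcomp Require Import measurable_realfun.
Import Order.TTheory GRing.Theory Num.Theory.
Import numFieldNormedType.Exports.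
Local Open Scope classical_set_scope.
Local Open Scope ring_scope.

(** Suppose first that U has a dichotomy with constants N and beta.  It
    trivially has P-growth.  Moreover [|G(tau,t)x|] is at most
    [N e^(-beta |tau - t|) |x|], so with p = 1 and gamma = beta / 2 the
    integrand is dominated by [N |x| e^(-(beta/2) |tau - t|)], whose integral
    over the whole line is [4 N |x| / beta] ([integral_expR_dist_le]).

    Conversely, the integral bound is turned into a pointwise bound by looking
    at a single time window of length one.  By the cocycle identities and the
    growth bound on time intervals of length at most one,
    [|U(t,s)P(s)x| <= M e^omega |G(tau,s)x|] for tau in [(t-1, t)], and
    [|V(s,t)Q(t)x| <= M e^omega |G(tau,t)x|] for tau in [(s, s+1)].  In both
    cases the integrand is at least a constant on a window that lies at
    distance at least [t-s-1] from the base point of the Green function, and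
    comparing that constant with the bound [K |x|^p] and taking p-th roots
    gives decay at rate gamma, with constant
    [M e^(omega + gamma) K^(1/p)] ([decay_of_window_integral]).  When
    [t-s <= 1] there is no room for such a window, but the growth bound itself
    is already of the required form ([decay_of_short_time]). *)

(** * Integrals of exponentials of the distance to a point *)

(** The integral of a nonnegative function is a supremum over the simple
    functions below it, so it is monotone even for functions that are not
    measurable.  This makes it possible to estimate the integral of the norm
    of the Green function from both sides without studying its regularity. *)
Lemma ge0_le_integral_subset {d} {T : measurableType d} {R : realType}
    (mu : {measure set T -> \bar R}) (D E : set T) (f g : T -> \bar R) :
  D `<=` E -> (forall x, D x -> (0 <= f x)%E) ->
  (forall x, E x -> (0 <= g x)%E) -> (forall x, D x -> (f x <= g x)%E) ->
  (\int[mu]_(x in D) f x <= \int[mu]_(x in E) g x)%E.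
Proof.
move=> DE f0 g0 fg; rewrite !ge0_integralE//.
apply: ge_ereal_sup => _ [h /= hf <-]; apply: ereal_sup_ubound.
exists h => //= x; apply: (le_trans (hf x)); rewrite !patchE.
case: ifPn => [/[!inE] Dx|_]; first by rewrite mem_set ?fg//; exact: DE.
by case: ifPn => // /[!inE] /g0.
Qed.

Lemma is_derive_expR_affine {R : realType} (k b x : R) : k != 0 ->
  is_derive x (1 : R) (fun y => k^-1 * expR (k * (y - b))) (expR (k * (x - b))).
Proof.
move=> k0.
have aff : is_derive x (1 : R) (k \*: ((@id R) - cst b)) (k *: (1 - 0)).
  by apply: is_deriveZ; apply: is_deriveB.
rewrite [X in is_derive _ _ X _](_ : _ =
    k^-1 \*: (expR \o (k \*: ((@id R) - cst b)))); last exact/funext.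
apply: is_derive_eq.
by rewrite /GRing.scale /= subr0 mulr1 mulrCA mulVf// mulr1.
Qed.

Lemma continuous_expR_affine {R : realType} (k b : R) :
  continuous (fun y : R => expR (k * (y - b))).
Proof.
move=> x; apply: continuous_comp; last exact: continuous_expR.
by apply: cvgMr; apply: cvgB; [exact: cvg_id | exact: cvg_cst].
Qed.

Lemma integral_expR_past {R : realType} (c a t : R) : 0 < c -> a < t ->
  (\int[lebesgue_measure]_(x in `[a, t]) (expR (c * (x - t)))%:E
   <= (c^-1)%:E)%E.
Proof.
move=> c0 a_lt_t; have dF x := is_derive_expR_affine _ t x (lt0r_neq0 c0).
pose F x := c^-1 * expR (c * (x - t)).
have cF x : {for x, continuous F}.
  by apply: cvgMr; exact: continuous_expR_affine.
rewrite (@continuous_FTC2 _ _ F)//.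
- rewrite -EFinB lee_fin /F subrr mulr0 expR0 mulr1 lerBlDr lerDl.
  by rewrite mulr_ge0// ?expR_ge0// invr_ge0 ltW.
- exact/continuous_subspaceT/continuous_expR_affine.
- split.
  + by move=> x _; exact: ex_derive.
  + exact/cvg_at_right_filter/cF.
  + exact/cvg_at_left_filter/cF.
- by move=> x _; rewrite derive1E; exact: derive_val.
Qed.

Lemma integral_expR_future {R : realType} (c t : R) : 0 < c ->
  (\int[lebesgue_measure]_(x in `[t, +oo[) (expR (- c * (x - t)))%:E
   = (c^-1)%:E)%E.
Proof.
move=> c0; have nc0 : - c != 0 by rewrite oppr_eq0 lt0r_neq0.
have dF x := is_derive_expR_affine _ t x nc0.
pose F x := (- c)^-1 * expR (- c * (x - t)).
have cF x : {for x, continuous F}.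
  by apply: cvgMr; exact: continuous_expR_affine.
rewrite (@ge0_continuous_FTC2y _ _ F _ 0)//.
- by rewrite sub0e -EFinN /F subrr mulr0 expR0 mulr1 invrN opprK.
- exact/continuous_subspaceT/continuous_expR_affine.
- rewrite -[X in _ --> X](mulr0 (- c)^-1); apply: cvgMr.
  have -> : (fun x => expR (- c * (x - t))) =
      (fun y => expR (- y)) \o (fun x => c * (x - t)).
    by apply/funext => x /=; rewrite mulNr.
  apply: cvg_comp; last exact: cvgr_expR.
  by apply: gt0_cvgMry => //; exact: cvg_addrr.
- exact/cvg_at_right_filter/cF.
- by move=> x _; rewrite derive1E; exact: derive_val.
Qed.

Lemma measurable_expR_dist {R : realType} (c t : R) (D : set R) :
  measurable_fun D (EFin \o (fun x : R => expR (- c * `|x - t|))).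
Proof.
apply/measurable_funTS/measurable_EFinP; apply: continuous_measurable_fun => x.
apply: continuous_comp; last exact: continuous_expR.
apply: cvgMr; apply: cvg_norm.
by apply: cvgB; [exact: cvg_id | exact: cvg_cst].
Qed.

Lemma integral_expR_dist_le {R : realType} (c t : R) : 0 < c -> 0 <= t ->
  (\int[lebesgue_measure]_(x in `[0%R, +oo[) (expR (- c * `|x - t|))%:E
   <= (2 / c)%:E)%E.
Proof.
move=> c0 t0; have t1 : - 1 < t by rewrite (lt_le_trans _ t0)// ltrN10.
have mexp := measurable_expR_dist c t.
apply: (@le_trans _ _ (\int[lebesgue_measure]_(x in `[(-1)%R, t] `|` `]t, +oo[)
    (expR (- c * `|x - t|))%:E)%E).
  (* Starting at -1 rather than 0 makes the first interval nondegenerate even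
     for t = 0, as the fundamental theorem of calculus requires. *)
  apply: ge0_le_integral_subset => // x /=.
  rewrite !in_itv /= !andbT => x0; case: (leP x t) => xt; last by right.
  by left; rewrite (le_trans _ x0)// lerN10.
rewrite ge0_integral_setU//=; last first.
  apply/disj_set2P/seteqP; split => // x /= [].
  by rewrite !in_itv/= andbT => /andP[_]; rewrite leNgt => /negP.
  exact: mexp.
rewrite integral_itv_obnd_cbnd; last exact: mexp.
rewrite (_ : 2 / c = c^-1 + c^-1); last by rewrite mulr2n mulrDl !mul1r.
rewrite EFinD; apply: leeD.
  apply: le_trans (integral_expR_past _ _ _ c0 t1).
  apply: ge0_le_integral_subset => // x /=; rewrite in_itv /= => /andP[_ xt].
  by rewrite ler0_norm ?subr_le0// mulrNN.
rewrite -(integral_expR_future _ t c0).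
apply: ge0_le_integral_subset => // x /=; rewrite in_itv /= andbT => tx.
by rewrite ger0_norm ?subr_ge0.
Qed.

(** * From an integral bound to a pointwise bound *)

(** The core of the converse implication, stated for a scalar function g so
    that it serves both the stable and the unstable part.  On the window
    [(u, u+1)] the integrand is at least [m^p], with
    [m = e^(gamma (d-1)) a / C]; hence [m^p <= K b^p]. *)
Lemma decay_of_window_integral {R : realType} (p K gamma C b u d a t : R)
    (g : R -> R) :
  0 < p -> 1 <= K -> 0 < gamma -> 0 < C -> 0 <= b -> 0 <= u -> 0 <= a ->
  (forall tau, 0 <= g tau) ->
  (forall tau, u < tau < u + 1 -> a <= C * g tau /\ d - 1 <= `|tau - t|) ->
  (\int[lebesgue_measure]_(tau in `[0%R, +oo[)
     (expR (p * gamma * `|tau - t|) * g tau `^ p)%:E <= (K * b `^ p)%:E)%E ->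
  a <= C * expR gamma * K `^ p^-1 * expR (- gamma * d) * b.
Proof.
move=> p0 K1 gamma0 C0 b0 u0 a0 g0 window int_le.
have K0 : 0 <= K by exact: le_trans K1.
pose m := expR (gamma * (d - 1)) * (a / C).
have aC0 : 0 <= a / C by rewrite divr_ge0// ltW.
have m0 : 0 <= m by rewrite mulr_ge0// expR_ge0.
have mp_le : m `^ p <= (K `^ p^-1 * b) `^ p.
  rewrite powRM ?powR_ge0// -powRrM mulVf ?gt_eqF// powRr1// -lee_fin.
  apply: le_trans int_le.
  have -> : (m `^ p)%:E = (\int[lebesgue_measure]_(tau in `]u, (u + 1)%R[)
      cst (m `^ p)%:E tau)%E.
    rewrite integral_cst//= lebesgue_measure_itv/= lte_fin ltrDl ltr01.
    by rewrite -EFinB (_ : u + 1 - u = 1) ?mule1; last by ring.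
  apply: ge0_le_integral_subset => [x|x _|x _|x].
  - by rewrite /= !in_itv/= andbT => /andP[/ltW ux _]; exact: le_trans ux.
  - by rewrite lee_fin powR_ge0.
  - by rewrite lee_fin mulr_ge0 ?expR_ge0 ?powR_ge0.
  - rewrite /= in_itv/= => /window[ag dt].
    rewrite lee_fin powRM ?expR_ge0// -expRM; apply: ler_pM.
    + exact: expR_ge0.
    + exact: powR_ge0.
    + rewrite ler_expR mulrC mulrA; apply: ler_wpM2l => //.
      by rewrite mulr_ge0// ltW.
    + by rewrite ge0_ler_powR ?nnegrE ?(ltW p0)// ler_pdivrMr// mulrC.
have m_le : m <= K `^ p^-1 * b.
  rewrite leNgt; apply/negP => lt_m.
  have := @gt0_ltr_powR _ p p0 (K `^ p^-1 * b) m.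
  rewrite !nnegrE m0 mulr_ge0 ?powR_ge0// => /(_ isT isT lt_m).
  by rewrite ltNge mp_le.
rewrite (_ : _ * b = C * expR (- (gamma * (d - 1))) * (K `^ p^-1 * b)); last first.
  by rewrite mulrBr mulr1 opprB expRD mulNr; ring.
rewrite [leLHS](_ : a = C * expR (- (gamma * (d - 1))) * m).
  by apply: ler_wpM2l m_le; rewrite mulr_ge0 ?expR_ge0 ?ltW.
rewrite /m expRN mulrA -[C * _ * _]mulrA mulVf ?gt_eqF ?expR_gt0//.
by rewrite mulr1 mulrC divfK ?gt_eqF.
Qed.

(** For [d <= 1] the factor [e^gamma K^(1/p) e^(-gamma d)] is at least one, so
    the constant of [decay_of_window_integral] also covers short times. *)
Lemma decay_of_short_time {R : realType} (p K gamma C b d a : R) :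
  0 < p -> 1 <= K -> 0 < gamma -> 0 <= C -> 0 <= b -> d <= 1 ->
  a <= C * b -> a <= C * expR gamma * K `^ p^-1 * expR (- gamma * d) * b.
Proof.
move=> p0 K1 gamma0 C0 b0 d1 /le_trans; apply; apply: ler_wpM2r => //.
have -> : C * expR gamma * K `^ p^-1 * expR (- gamma * d) =
    C * (expR (gamma * (1 - d)) * K `^ p^-1).
  by rewrite mulrBr mulr1 expRD mulNr; ring.
rewrite -[leLHS]mulr1; apply: ler_wpM2l => //.
rewrite -[leLHS]mulr1; apply: ler_pM => //.
  by rewrite -[leLHS]expR0 ler_expR mulr_ge0 ?subr_ge0 ?(ltW gamma0).
have <- : (1 : R) `^ p^-1 = 1 by rewrite powR1.
rewrite ge0_ler_powR ?nnegrE ?invr_ge0 ?(ltW p0)//.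
exact: le_trans K1.
Qed.

(** * The real-valued norm and operator bounds *)

Lemma rnorm_ge0 {R : realType} {k : scalar_kind}
    {X : completeNormedModType (scalars R k)} (x : X) : 0 <= rnorm x.
Proof.
have := normr_ge0 x; rewrite /rnorm; case: k X x => X x //=.
by rewrite lecE => /andP[].
Qed.

Lemma rnorm0 {R : realType} {k : scalar_kind}
    {X : completeNormedModType (scalars R k)} : rnorm (0 : X) = 0.
Proof. by rewrite /rnorm normr0; case: k X. Qed.

Lemma rnormN {R : realType} {k : scalar_kind}
    {X : completeNormedModType (scalars R k)} (x : X) : rnorm (- x) = rnorm x.
Proof. by rewrite /rnorm normrN. Qed.

Lemma rnorm_eq0 {R : realType} {k : scalar_kind}
    {X : completeNormedModType (scalars R k)} (x : X) : rnorm x = 0 -> x = 0.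
Proof.
move=> x0; apply/eqP; rewrite -normr_eq0; apply/eqP; move: x0.
have := normr_ge0 x; rewrite /rnorm; case: k X x => X x //=.
by rewrite lecE; case: (`|x|) => re im /= /andP[/eqP-> _] ->.
Qed.

(** Nonnegative reals embed in both kinds of scalars; this is all the scalar
    arithmetic required to normalize a vector. *)
Lemma rnorm_scale_ex {R : realType} {k : scalar_kind}
    (X : completeNormedModType (scalars R k)) (c : R) : 0 <= c ->
  exists a : scalars R k, forall x : X, rnorm (a *: x) = c * rnorm x.
Proof.
move=> c0; case: k X => X.
  by exists c => x; rewrite /rnorm /= normrZ ger0_norm.
exists (c%:C)%C => x; rewrite /rnorm /= normrZ ger0_norm ?lecR//.
by case: (`|x|) => re im /=; rewrite mul0r subr0.
Qed.

(** A nonzero vector is rescaled to the unit ball.  The hypothesis is plain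
    homogeneity so that the lemma applies directly to [Vinv] after [Qproj],
    where homogeneity comes from uniqueness of preimages on the kernel. *)
Lemma opnorm_leP {R : realType} {k : scalar_kind}
    {X : completeNormedModType (scalars R k)} (A : X -> X) (c : R) :
  0 <= c -> (forall a x, A (a *: x) = a *: A x) ->
  ((opnorm A <= c%:E)%E <-> forall x, rnorm (A x) <= c * rnorm x).
Proof.
move=> c0 Ahom; split => [Ac x|Ac].
  have [x0|x0] := eqVneq (rnorm x) 0.
    have A0 : A 0 = 0 by rewrite -[X in A X](scale0r (0 : X)) Ahom scale0r.
    by rewrite (rnorm_eq0 _ x0) A0 rnorm0 mulr0.
  have xpos : 0 < rnorm x by rewrite lt_def x0 rnorm_ge0.
  have [|a ax] := rnorm_scale_ex X (rnorm x)^-1; first by rewrite invr_ge0 ltW.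
  rewrite -ler_pdivrMr// mulrC -ax -Ahom -lee_fin.
  apply: le_trans Ac; apply: ereal_sup_ubound; exists (a *: x) => //=.
  by rewrite ax mulVf.
apply: ge_ereal_sup => _ [x /= x1 <-]; rewrite lee_fin.
by apply: le_trans (Ac x) _; rewrite ler_piMr.
Qed.

(** * Cocycle identities for the evolution operator and its inverse *)

Section Cocycle.
Context {R : realType} {k : scalar_kind}.
Context {X : completeNormedModType (scalars R k)}.
Context {U : R -> R -> X -> X} {P : R -> X -> X}.
Hypotheses (evU : evolution_operator U) (projP : projection_valued P).
Hypothesis cUP : compatible U P.

Lemma evolution_linear {t s : R} : 0 <= s <= t -> linear (U t s).
Proof. by case: evU => + _ _ _ => /[apply] -[]. Qed.

Lemma projection_linear {t : R} : 0 <= t -> linear (P t).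
Proof. by case: projP => + _ _ => /[apply] -[]. Qed.

Lemma linear_homogeneous (A : X -> X) : linear A ->
  forall a x, A (a *: x) = a *: A x.
Proof.
move=> Alin; have A0 : A 0 = 0.
  by have := Alin (-1) 0 0; rewrite scaler0 addr0 scaleN1r addNr.
by move=> a x; rewrite -[a *: x]addr0 Alin A0 addr0.
Qed.

Lemma Qproj_Ker {t : R} (x : X) : 0 <= t -> Ker (P t) (Qproj P t x).
Proof.
move=> t0; rewrite /Ker /Qproj /=.
rewrite addrC -scaleN1r (projection_linear t0) scaleN1r.
case: projP => _ _ /(_ t t0) /(congr1 (@^~ x)) /= ->.
exact: addNr.
Qed.

Lemma Qproj_homogeneous {t : R} : 0 <= t ->
  forall a x, Qproj P t (a *: x) = a *: Qproj P t x.
Proof.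
move=> t0 a x; rewrite /Qproj scalerBr.
by rewrite (linear_homogeneous _ (projection_linear t0)).
Qed.

Lemma Qproj_id {t : R} (x : X) : Ker (P t) x -> Qproj P t x = x.
Proof. by rewrite /Ker /Qproj /= => ->; rewrite subr0. Qed.

Lemma Ker_scale {t : R} a (x : X) : 0 <= t -> Ker (P t) x -> Ker (P t) (a *: x).
Proof.
move=> t0; rewrite /Ker /= (linear_homogeneous _ (projection_linear t0)) => ->.
exact: scaler0.
Qed.

Lemma Vinv_eq {t s : R} (z : X) : 0 <= s <= t -> Ker (P s) z ->
  Vinv U P s t (U t s z) = z.
Proof.
move=> st zK; case: (cUP t s st) => _ [_ inj _] _.
by apply: pinvKV => //; exact: mem_set.
Qed.

(** Every identity for [Vinv] below is obtained by writing its argument as an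
    image [U t s z] and using the injectivity of [U t s] on the kernel. *)
Lemma Vinv_preimage {t s : R} {y : X} : 0 <= s <= t -> Ker (P t) y ->
  exists z, [/\ Ker (P s) z, U t s z = y & Vinv U P s t y = z].
Proof.
move=> st yK; case: (cUP t s st) => _ [_ _ /(_ y yK)[z zK <-]] _.
by exists z; split => //; exact: Vinv_eq.
Qed.

Lemma Vinv_scale {t s : R} a (y : X) : 0 <= s <= t -> Ker (P t) y ->
  Vinv U P s t (a *: y) = a *: Vinv U P s t y.
Proof.
move=> st yK; have [z [zK <- ->]] := Vinv_preimage st yK.
rewrite -(linear_homogeneous _ (evolution_linear st)) Vinv_eq//.
by apply: Ker_scale => //; case/andP: st.
Qed.

Lemma evolution_comp {t r s : R} (x : X) : 0 <= s -> s <= r -> r <= t ->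
  U t r (U r s x) = U t s x.
Proof.
move=> s0 sr rt; case: evU => _ _ /(_ t r s s0 sr rt) + _.
by move=> /(congr1 (@^~ x)).
Qed.

Lemma Vinv_comp {t r s : R} (y : X) : 0 <= s -> s <= r -> r <= t ->
  Ker (P t) y -> Vinv U P s r (Vinv U P r t y) = Vinv U P s t y.
Proof.
move=> s0 sr rt yK.
have r0 : 0 <= r := le_trans s0 sr.
have [|z [zK <- ->]] := @Vinv_preimage t r y _ yK; first by rewrite r0.
have [|w [wK <- ->]] := @Vinv_preimage r s z _ zK; first by rewrite s0.
by rewrite evolution_comp// Vinv_eq// s0 (le_trans sr).
Qed.

Lemma evolution_proj {t s : R} (x : X) : 0 <= s <= t ->
  P t (U t s x) = U t s (P s x).
Proof. by move=> st; case: (cUP t s st) => /(congr1 (@^~ x)). Qed.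

Lemma projectionK {t : R} (x : X) : 0 <= t -> P t (P t x) = P t x.
Proof. by move=> t0; case: projP => _ _ /(_ t t0) /(congr1 (@^~ x)). Qed.

Lemma stable_opnorm_leP {t s c : R} : 0 <= s <= t -> 0 <= c ->
  ((opnorm (U t s \o P s) <= c%:E)%E <->
   forall x, rnorm (U t s (P s x)) <= c * rnorm x).
Proof.
move=> st c0; apply: opnorm_leP => // a x /=.
rewrite (linear_homogeneous _ (projection_linear _)); last by case/andP: st.
exact: linear_homogeneous _ (evolution_linear st) _ _.
Qed.

Lemma unstable_opnorm_leP {t s c : R} : 0 <= s <= t -> 0 <= c ->
  ((opnorm (Vinv U P s t \o Qproj P t) <= c%:E)%E <->
   forall x, rnorm (Vinv U P s t (Qproj P t x)) <= c * rnorm x).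
Proof.
move=> st c0; have t0 : 0 <= t by case/andP: st => ? /(le_trans _); apply.
apply: opnorm_leP => // a x /=.
by rewrite Qproj_homogeneous// Vinv_scale//; exact: Qproj_Ker.
Qed.

(** * The two implications *)

Lemma Green_stable {tau t : R} (x : X) : t < tau ->
  Green U P tau t x = U tau t (P t x).
Proof. by rewrite /Green => ->. Qed.

Lemma Green_unstable {tau t : R} (x : X) : tau < t ->
  Green U P tau t x = - Vinv U P tau t (Qproj P t x).
Proof. by move=> lt; rewrite /Green lt ltNge ltW. Qed.

Lemma dichotomy_Green_le {N beta tau t : R} (x : X) :
  0 <= N -> 0 <= tau -> 0 <= t ->
  (forall t s, Delta_plus (t, s) ->
      (opnorm (U t s \o P s) <= (N * expR (- beta * (t - s)))%:E)%E /\
      (opnorm (Vinv U P s t \o Qproj P t)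
         <= (N * expR (- beta * (t - s)))%:E)%E) ->
  rnorm (Green U P tau t x) <= N * expR (- beta * `|tau - t|) * rnorm x.
Proof.
move=> N0 tau0 t0 dich; have [lt|] := ltP tau t; last rewrite le_eqVlt => /predU1P[<-|gt].
- have D : 0 <= tau <= t by rewrite tau0 ltW.
  rewrite Green_unstable// rnormN distrC ger0_norm ?subr_ge0 ?(ltW lt)//.
  apply: (unstable_opnorm_leP D _).1; first by rewrite mulr_ge0 ?expR_ge0.
  by have [] := dich _ _ D.
- by rewrite /Green ltxx rnorm0 !mulr_ge0 ?expR_ge0 ?rnorm_ge0.
- have D : 0 <= t <= tau by rewrite t0 ltW.
  rewrite Green_stable// ger0_norm ?subr_ge0 ?(ltW gt)//.
  apply: (stable_opnorm_leP D _).1; first by rewrite mulr_ge0 ?expR_ge0.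
  by have [] := dich _ _ D.
Qed.

Lemma dichotomy_growth :
  uniform_exponential_dichotomy U P -> uniform_exponential_growth U P.
Proof.
move=> [N [beta [N1 beta0 dich]]]; exists N, beta; split=> // t s D.
have le_exp : ((N * expR (- beta * (t - s)))%:E <=
               (N * expR (beta * (t - s)))%:E)%E.
  have /andP[s0 st] : 0 <= s <= t by [].
  rewrite lee_fin ler_wpM2l ?(le_trans _ N1)// ler_expR ler_wpM2r ?subr_ge0//.
  by rewrite (le_trans _ (ltW beta0))// oppr_le0 ltW.
by have [PU QV] := dich t s D; split; apply: le_trans le_exp.
Qed.

Lemma dichotomy_integral : uniform_exponential_dichotomy U P ->
  exists p K gamma : R, [/\ 0 < p, 1 <= K, 0 < gamma &
    forall (t : R) (x : X), 0 <= t ->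
      (\int[lebesgue_measure]_(tau in `[0%R, +oo[)
         (expR (p * gamma * `|tau - t|) * rnorm (Green U P tau t x) `^ p)%:E
       <= (K * rnorm x `^ p)%:E)%E].
Proof.
move=> [N [beta [N1 beta0 dich]]].
have N0 : 0 <= N by exact: le_trans N1.
have b20 : 0 < beta / 2 by rewrite divr_gt0.
have C0 : 0 <= N * (2 / (beta / 2)) by rewrite mulr_ge0// divr_ge0// ltW.
exists 1, (1 + N * (2 / (beta / 2))), (beta / 2); split => //.
  by rewrite lerDl.
move=> t x t0; rewrite powRr1 ?rnorm_ge0// mul1r.
have Nx0 : 0 <= N * rnorm x by rewrite mulr_ge0 ?rnorm_ge0.
apply: (@le_trans _ _ (\int[lebesgue_measure]_(tau in `[0%R, +oo[)
  ((N * rnorm x)%:E * (expR (- (beta / 2) * `|tau - t|))%:E))%E).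
  apply: ge0_le_integral_subset => // tau /=.
  - by rewrite lee_fin mulr_ge0 ?expR_ge0 ?powR_ge0.
  - by rewrite -EFinM lee_fin mulr_ge0 ?expR_ge0.
  rewrite in_itv/= andbT => tau0.
  rewrite powRr1 ?rnorm_ge0// -EFinM lee_fin.
  apply: le_trans.
    apply: ler_wpM2l; first exact: expR_ge0.
    exact: (dichotomy_Green_le x N0 tau0 t0 dich).
  rewrite [leLHS](_ : _ = N * rnorm x *
    (expR (beta / 2 * `|tau - t|) * expR (- beta * `|tau - t|))); last by ring.
  by rewrite -expRD -mulrDl (_ : beta / 2 + - beta = - (beta / 2))//; field.
rewrite ge0_integralZl_EFin//; last exact: measurable_expR_dist.
apply: (@le_trans _ _ ((N * rnorm x)%:E * (2 / (beta / 2))%:E)%E).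
  by apply: lee_wpmul2l; rewrite ?lee_fin//; exact: integral_expR_dist_le.
by rewrite -EFinM lee_fin mulrAC [leRHS]mulrDl mul1r lerDr rnorm_ge0.
Qed.

Lemma growth_short_le {M omega : R} : 1 <= M -> 0 < omega ->
  (forall t s, Delta_plus (t, s) ->
      (opnorm (U t s \o P s) <= (M * expR (omega * (t - s)))%:E)%E /\
      (opnorm (Vinv U P s t \o Qproj P t)
         <= (M * expR (omega * (t - s)))%:E)%E) ->
  forall (t s : R) (x : X), 0 <= s <= t -> t - s <= 1 ->
    rnorm (U t s (P s x)) <= M * expR omega * rnorm x /\
    rnorm (Vinv U P s t (Qproj P t x)) <= M * expR omega * rnorm x.
Proof.
move=> M1 omega0 growth t s x D d1; have [PU QV] := growth t s D.
have M0 : 0 <= M by exact: le_trans M1.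
have Me0 : 0 <= M * expR omega by rewrite mulr_ge0 ?expR_ge0.
have le_exp : ((M * expR (omega * (t - s)))%:E <= (M * expR omega)%:E)%E.
  by rewrite lee_fin ler_wpM2l// ler_expR -[leRHS]mulr1 ler_wpM2l// ltW.
split.
- by apply: (stable_opnorm_leP D Me0).1; exact: le_trans le_exp.
- by apply: (unstable_opnorm_leP D Me0).1; exact: le_trans le_exp.
Qed.

Lemma dichotomy_of_growth_integral : uniform_exponential_growth U P ->
  (exists p K gamma : R, [/\ 0 < p, 1 <= K, 0 < gamma &
    forall (t : R) (x : X), 0 <= t ->
      (\int[lebesgue_measure]_(tau in `[0%R, +oo[)
         (expR (p * gamma * `|tau - t|) * rnorm (Green U P tau t x) `^ p)%:E
       <= (K * rnorm x `^ p)%:E)%E]) ->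
  uniform_exponential_dichotomy U P.
Proof.
move=> [M [omega [M1 omega0 growth]]] [p [K [gamma [p0 K1 gamma0 int_le]]]].
have short := growth_short_le M1 omega0 growth.
have C1 : 1 <= M * expR omega.
  by rewrite -[leLHS]mulr1 ler_pM// -[leLHS]expR0 ler_expR ltW.
have C0 : 0 < M * expR omega by exact: lt_le_trans C1.
pose N := M * expR omega * expR gamma * K `^ p^-1.
(* The short-time estimate at d = 0 with a = b = 1 says exactly that N >= 1. *)
have N1 : 1 <= N.
  have := @decay_of_short_time R p K gamma (M * expR omega) 1 0 1 p0 K1 gamma0
    (ltW C0) ler01 ler01.
  by rewrite !mulr0 expR0 !mulr1; apply.
exists N, gamma; split => // t s D.
have /andP[s0 st] : 0 <= s <= t by [].
have t0 : 0 <= t by exact: le_trans st.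
have Nd0 : 0 <= N * expR (- gamma * (t - s)).
  by rewrite mulr_ge0 ?expR_ge0 ?(le_trans _ N1).
split.
- apply/(stable_opnorm_leP D Nd0) => x.
  have [d1|d1] := leP (t - s) 1.
    apply: decay_of_short_time; rewrite ?rnorm_ge0 ?(ltW C0)//.
    by have [] := short t s x D d1.
  (* Here the window is the last unit of time before t: U(t,s) factors as
     U(t,tau) U(tau,s), and the first factor covers a time at most one. *)
  apply: (@decay_of_window_integral R p K gamma _ _ (t - 1) _ _ s
      (fun tau => rnorm (Green U P tau s x))); rewrite ?rnorm_ge0//.
  + by rewrite subr_ge0; lra.
  + by move=> tau; exact: rnorm_ge0.
  + move=> tau /andP[tau1 tau2]; have s_tau : s < tau by lra.
    have tau_t : tau <= t by lra.
    have Dtau : 0 <= tau <= t by apply/andP; split; lra.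
    have Ds : 0 <= s <= tau by apply/andP; split; lra.
    split; last by rewrite ger0_norm; lra.
    have [|+ _] := short t tau (U tau s (P s x)) Dtau; first by lra.
    rewrite Green_stable// (evolution_proj _ Ds) projectionK//.
    by rewrite (evolution_comp _ s0 (ltW s_tau) tau_t).
  + exact: int_le.
- apply/(unstable_opnorm_leP D Nd0) => x.
  have [d1|d1] := leP (t - s) 1.
    apply: decay_of_short_time; rewrite ?rnorm_ge0 ?(ltW C0)//.
    by have [] := short t s x D d1.
  (* Here the window is the first unit of time after s: V(s,t) factors as
     V(s,tau) V(tau,t), and the first factor covers a time at most one. *)
  apply: (@decay_of_window_integral R p K gamma _ _ s _ _ t
      (fun tau => rnorm (Green U P tau t x))); rewrite ?rnorm_ge0//.
  + by move=> tau; exact: rnorm_ge0.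
  + move=> tau /andP[tau1 tau2]; have tau_t : tau < t by lra.
    have Dtau : 0 <= s <= tau by apply/andP; split; lra.
    split; last by rewrite distrC ger0_norm; lra.
    have tau0 : 0 <= tau by lra.
    have QK := Qproj_Ker x t0.
    have [|z [zK _ Vz]] := @Vinv_preimage t tau _ _ QK; first by apply/andP; split; lra.
    have [|_ +] := short tau s z Dtau; first by lra.
    rewrite Qproj_id// Green_unstable// rnormN Vz -Vz.
    by rewrite (Vinv_comp _ s0 (ltW tau1) (ltW tau_t) QK).
  + exact: int_le.
Qed.

End Cocycle.

Theorem corollary3p6 (R : realType) (k : scalar_kind)
    (X : completeNormedModType (scalars R k))
    (U : R -> R -> X -> X) (P : R -> X -> X) :
  evolution_operator U -> projection_valued P -> compatible U P ->
  (uniform_exponential_dichotomy U P <->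
   (uniform_exponential_growth U P /\
    exists p K gamma : R, [/\ 0 < p, 1 <= K, 0 < gamma &
      forall (t : R) (x : X), 0 <= t ->
        (\int[lebesgue_measure]_(tau in `[0%R, +oo[)
           (expR (p * gamma * `|tau - t|) * rnorm (Green U P tau t x) `^ p)%:E
         <= (K * rnorm x `^ p)%:E)%E])).
Proof.
move=> evU projP cUP; split => [dich|[growth int_le]].
  by split; [exact: dichotomy_growth | exact: dichotomy_integral].
exact: dichotomy_of_growth_integral.
Qed.
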